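(* Let $A$ be a Green $\mathcal{D}$-biset functor over $k$. The following statements are equivalent: 1. There is an anti-involution $\_^{\star}$ on $A$. 2. There is an isomorphism of Green biset functors $\delta:A\longrightarrow A^{op}$ such that $\delta^{op}=\delta^{-1}$. 3. There is a $k$-linear functor $\_^{\bullet}:\mathcal{P}_A\longrightarrow \mathcal{P}_A^{op}$ which is the identity on objects and satisfies: (a) $(\_^{\bullet})^{op}\circ \_^{\bullet}=\mathrm{Id}_{\mathcal{P}_A}$; (b) for all $G,H,K,L\in Ob(\mathcal{D})$, all $x\in B_k(L\times K,H\times G)$ and all $\alpha\in \mathcal{P}_A(G,H)=A(H\times G)$, $$(T^{-1}\circ \_^{\bullet})\big(A(x)(\alpha)\big)=A^{op}(x)\big((T^{-1}\circ \_^{\bullet})(\alpha)\big)$$ in $\mathcal{P}_{A^{op}}(K,L)=A^{op}(L\times K)$, where $T:\mathcal{P}_{A^{op}}\longrightarrow\mathcal{P}_A^{op}$ is the isomorphism of categories described in the context.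
   Context: All groups are finite; rings and algebras are associative and unital, with unit-preserving homomorphisms. Let $k$ be a commutative ring. $B(H,G)$ is the Burnside (Grothendieck) group of finite $(H,G)$-bisets (with $[X\sqcup Y]=[X]+[Y]$), and $B_k(H,G)=k\otimes B(H,G)$. The composition of a $(K,H)$-biset $Y$ and an $(H,G)$-biset $X$ is $Y\circ X=Y\times_H X$, the quotient of $Y\times X$ by $(yh,x)\sim(y,hx)$. The biset category $\mathcal{C}$ has all finite groups as objects, $Hom_{\mathcal{C}}(G,H)=B(H,G)$, composition $\circ$, and identity of $G$ the regular $(G,G)$-biset $G$. $\mathcal{D}\subseteq\mathcal{C}$ is a full subcategory whose objects are closed under subquotients and direct products; $k\mathcal{D}$ is its $k$-linearization. A $\mathcal{D}$-biset functor over $k$ is a $k$-linear functor $k\mathcal{D}\to {}_kMod$; morphisms are natural transformations. For a homomorphism $\phi:G\to H$: $Ind(\phi)$ is $H$ as an $(H,G)$-biset ($h'\cdot h\cdot g=h'h\phi(g)$), $Res(\phi)$ is $H$ as a $(G,H)$-biset ($g\cdot h\cdot h'=\phi(g)hh'$), and $Iso(\phi)=Ind(\phi)$ if $\phi$ is an isomorphism. Inflation from a quotient is $Res$ of the projection; $Inf_G^{G\times H}$ is $Res$ of the projection $G\times H\to G$. $\tau_{G,H}:G\times H\to H\times G$ is $(g,h)\mapsto(h,g)$. A Green $\mathcal{D}$-biset functor over $k$ is a $\mathcal{D}$-biset functor $A$ such that each $A(G)$ is a $k$-algebra and, for each homomorphism $\phi:G\to H$ of groups in $Ob(\mathcal{D})$: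 $A(Res(\phi))$ is a $k$-algebra homomorphism, and $a\,A(Ind(\phi))(b)=A(Ind(\phi))(A(Res(\phi))(a)b)$, $A(Ind(\phi))(b)\,a=A(Ind(\phi))(b\,A(Res(\phi))(a))$ for $a\in A(H)$, $b\in A(G)$. A morphism of Green biset functors is a natural transformation whose components are $k$-algebra homomorphisms. For $a\in A(G)$, $b\in A(H)$ put $a\times b=A(Inf_G^{G\times H})(a)\,A(Inf_H^{G\times H})(b)\in A(G\times H)$, and let $\epsilon_A=1\in A(1)$. The opposite $A^{op}$ is the functor $A$ with the opposite multiplication on each $A(G)$; for a morphism $f:A\to C$, $f^{op}:A^{op}\to C^{op}$ has the same components; $(A^{op})^{op}=A$. An anti-involution on $A$ is an endomorphism $\_^{\star}:A\to A$ of biset functors with $a^{\star\star}=a$ and $(ab)^{\star}=b^{\star}a^{\star}$ for all $a,b\in A(G)$ and $G\in Ob(\mathcal{D})$. The associated category $\mathcal{P}_A$ has objects $Ob(\mathcal{D})$, $Hom_{\mathcal{P}_A}(G,H)=\mathcal{P}_A(G,H)=A(H\times G)$, composition $\alpha\circ\beta=A(K\times\overleftarrow{H}\times G)(\alpha\times\beta)$ for $\alpha\in A(K\times H)$, $\beta\in A(H\times G)$, and identity $A(\overrightarrow{G})(\epsilon_A)$ of $G$. Here $\overrightarrow{G}$ is $G$ as a $(G\times G,1)$-biset via $(g_1,g_2)\cdot g=g_1gg_2^{-1}$, and $K\times\overleftarrow{H}\times G$ is the $(K\times G,K\times H\times H\times G)$-biset $K\times H\times G$ with $(k',g')\cdot(k,h,g)\cdot(k_1,h_1,h_2,g_1)=(k'kk_1,h_1^{-1}hh_2,g'gg_1)$.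 The isomorphism $T:\mathcal{P}_{A^{op}}\to\mathcal{P}_A^{op}$ of $k$-linear categories is the identity on objects and is given on $\mathcal{P}_{A^{op}}(G,H)=A(H\times G)$ by $A(Iso(\tau_{H,G})):A(H\times G)\to A(G\times H)=\mathcal{P}_A^{op}(G,H)$. *)

(* Defs.v *)
From HB Require Import structures.
From mathcomp Require Import all_boot all_order all_algebra all_fingroup.
From mathcomp Require Import boolp.

Set Implicit Arguments.
Unset Strict Implicit.
Unset Printing Implicit Defensive.

Import GRing.Theory.
Local Open Scope quotient_scope.
Local Open Scope ring_scope.

(* fingroup shadows the quotient representative with its own [repr] *)
Local Notation qrepr := generic_quotient.repr.

Definition unit_mul (_ _ : unit) := tt.
Definition unit_inv (_ : unit) := tt.

Lemma unit_mulA : associative unit_mul. Proof. by []. Qed.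
Lemma unit_mul1g : left_id tt unit_mul. Proof. by case. Qed.
Lemma unit_mulVg : left_inverse tt unit_inv unit_mul. Proof. by []. Qed.

HB.instance Definition _ :=
  Finite_isGroup.Build unit unit_mulA unit_mul1g unit_mulVg.

Notation hom G H := {morphism [set: G] >-> H}.

Section Morphisms.
Variables G H K : finGroupType.

Lemma homM (f : hom G H) x y : f (x * y)%g = (f x * f y)%g.
Proof. by apply: morphM; rewrite inE. Qed.

Lemma hom1 (f : hom G H) : f 1%g = 1%g.
Proof. exact: morph1. Qed.

Definition id_hom : hom G G := @Morphism _ _ setT (fun x : G => x)
  (in2W (fun x y : G => erefl (x * y)%g)).
Definition fst_hom : hom (G * H)%type G := fst_morphism G H.
Definition snd_hom : hom (G * H)%type H := snd_morphism G H.

Definition tau_fun (x : G * H) : H * G := (x.2, x.1).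
Lemma tau_funM : {morph tau_fun : x y / (x * y)%g}. Proof. by []. Qed.
Definition tau_hom : hom (G * H)%type (H * G)%type :=
  @Morphism _ _ setT _ (in2W tau_funM).

End Morphisms.

Record biact (H G : finGroupType) (X : Type) := Biact {
  blact : H -> X -> X;
  bract : X -> G -> X;
  blact1 : forall x, blact 1%g x = x;
  blactM : forall a b x, blact (a * b)%g x = blact a (blact b x);
  bract1 : forall x, bract x 1%g = x;
  bractM : forall x a b, bract x (a * b)%g = bract (bract x a) b;
  blractA : forall h x g, blact h (bract x g) = bract (blact h x) g }.

Record biset (H G : finGroupType) :=
  Biset { bcar :> finType; bact : biact H G bcar }.

Definition lact (H G : finGroupType) (X : biset H G) : H -> X -> X :=
  blact (bact X).
Definition ract (H G : finGroupType) (X : biset H G) : X -> G -> X :=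
  bract (bact X).

Notation "h *< x" := (lact h x) (at level 40, left associativity).
Notation "x >* g" := (ract x g) (at level 40, left associativity).

Definition biso (H G : finGroupType) (X Y : biset H G) : Prop :=
  exists f : X -> Y,
    [/\ bijective f, forall h x, f (h *< x) = h *< f x
      & forall x g, f (x >* g) = f x >* g].

Section BisetTheory.
Variables H G : finGroupType.
Implicit Types X Y Z : biset H G.

Lemma lact1 X (x : X) : 1%g *< x = x. Proof. exact: blact1. Qed.
Lemma lactM X a b (x : X) : (a * b)%g *< x = a *< (b *< x).
Proof. exact: blactM. Qed.
Lemma ract1 X (x : X) : x >* 1%g = x. Proof. exact: bract1. Qed.
Lemma ractM X (x : X) a b : x >* (a * b)%g = x >* a >* b.
Proof. exact: bractM. Qed.
Lemma lractA X h (x : X) g : h *< (x >* g) = h *< x >* g.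
Proof. exact: blractA. Qed.
Lemma lactK X h (x : X) : h^-1%g *< (h *< x) = x.
Proof. by rewrite -lactM mulVg lact1. Qed.
Lemma lactKV X h (x : X) : h *< (h^-1%g *< x) = x.
Proof. by rewrite -lactM mulgV lact1. Qed.
Lemma ractK X g (x : X) : x >* g >* g^-1%g = x.
Proof. by rewrite -ractM mulgV ract1. Qed.
Lemma ractKV X g (x : X) : x >* g^-1%g >* g = x.
Proof. by rewrite -ractM mulVg ract1. Qed.

Lemma inj_surj_bij (S T : Type) (f : S -> T) :
  injective f -> (forall y, exists x, f x = y) -> bijective f.
Proof.
move=> injf surj; exists (fun y => projT1 (cid (surj y))).
  by move=> x; apply: injf; case: cid.
by move=> y; case: cid.
Qed.

Lemma biso_refl X : biso X X.
Proof. by exists id; split=> //; exists id. Qed.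

Lemma biso_sym X Y : biso X Y -> biso Y X.
Proof.
case=> f [[g fK gK] fl fr]; exists g; split; first by exists f.
- by move=> h x; apply: (can_inj fK); rewrite fl !gK.
- by move=> x a; apply: (can_inj fK); rewrite fr !gK.
Qed.

Lemma biso_trans X Y Z : biso X Y -> biso Y Z -> biso X Z.
Proof.
case=> f [bf fl fr] [g [bg gl gr]]; exists (g \o f); split.
- exact: bij_comp.
- by move=> h x /=; rewrite fl gl.
- by move=> x a /=; rewrite fr gr.
Qed.

Definition bempty_act : biact H G void :=
  @Biact H G void (fun _ x => x) (fun x _ => x)
    (fun _ => erefl) (fun _ _ _ => erefl) (fun _ => erefl)
    (fun _ _ _ => erefl) (fun _ _ _ => erefl).
Definition bempty : biset H G := Biset bempty_act.

Section Union.
Variables X Y : biset H G.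
Definition bsum_lact h (z : X + Y) : X + Y :=
  match z with inl x => inl (h *< x) | inr y => inr (h *< y) end.
Definition bsum_ract (z : X + Y) g : X + Y :=
  match z with inl x => inl (x >* g) | inr y => inr (y >* g) end.
Definition bsum_act : biact H G (X + Y).
Proof.
exists bsum_lact bsum_ract.
- by case=> x /=; rewrite lact1.
- by move=> a b [] x /=; rewrite lactM.
- by case=> x /=; rewrite ract1.
- by move=> [] x a b /=; rewrite ractM.
- by move=> h [] x g /=; rewrite lractA.
Defined.
Definition bsum : biset H G := Biset bsum_act.
End Union.
End BisetTheory.

Section Composition.
Variables (K H G : finGroupType) (Y : biset K H) (X : biset H G).

Definition bcomp_rel (p q : Y * X) : bool :=
  [exists h : H, (p.1 == q.1 >* h) && (h *< p.2 == q.2)].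

Lemma bcomp_relP p q :
  reflect (exists2 h, p.1 = q.1 >* h & h *< p.2 = q.2) (bcomp_rel p q).
Proof.
apply: (iffP existsP) => [[h /andP[/eqP ? /eqP ?]]|[h -> <-]]; exists h => //.
by rewrite !eqxx.
Qed.

Lemma bcomp_rel_equiv : equiv_class_of bcomp_rel.
Proof.
split.
- by move=> p; apply/bcomp_relP; exists 1%g; rewrite (ract1, lact1).
- have sym p q : bcomp_rel p q -> bcomp_rel q p.
    case/bcomp_relP=> h e1 e2; apply/bcomp_relP; exists h^-1%g.
      by rewrite e1 ractK.
    by rewrite -e2 lactK.
  by move=> p q; apply/idP/idP; apply: sym.
- move=> q p r /bcomp_relP[h e1 e2] /bcomp_relP[h' e3 e4]; apply/bcomp_relP.
  by exists (h' * h)%g; rewrite ?ractM ?lactM -?e3 // e2.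
Qed.
Canonical bcomp_equiv_rel := EquivRelPack bcomp_rel_equiv.

Definition bcomp_car : Type := {eq_quot bcomp_rel}.
HB.instance Definition _ := Quotient.on bcomp_car.
HB.instance Definition _ := isEqQuotient.Build _ bcomp_rel bcomp_car (fun x y => EquivQuot.eqmodE _ _ _).
HB.instance Definition _ := Finite.copy bcomp_car (can_type (@reprK _ bcomp_car)).

Definition bpair (y : Y) (x : X) : bcomp_car := \pi_bcomp_car (y, x).
Definition bcomp_lact (k : K) (z : bcomp_car) :=
  bpair (k *< (qrepr z).1) (qrepr z).2.
Definition bcomp_ract (z : bcomp_car) (g : G) :=
  bpair (qrepr z).1 ((qrepr z).2 >* g).

Lemma bpairP y x y' x' :
  bpair y x = bpair y' x' <-> exists2 h, y = y' >* h & h *< x = x'.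
Proof.
split; first by move/eqquotP/bcomp_relP.
by move=> e; apply/eqquotP/bcomp_relP.
Qed.

Lemma bpairMl y h x : bpair (y >* h) x = bpair y (h *< x).
Proof. by apply/bpairP; exists h. Qed.

Lemma bcomp_ind (P : bcomp_car -> Prop) :
  (forall y x, P (bpair y x)) -> forall z, P z.
Proof. by move=> IH z; rewrite -[z]reprK; case: (qrepr z). Qed.

Lemma bcomp_lactE k y x : bcomp_lact k (bpair y x) = bpair (k *< y) x.
Proof.
rewrite /bcomp_lact; case E: (qrepr _) => [y' x'] /=.
have: bpair y' x' = bpair y x by rewrite {1}/bpair -E reprK.
by case/bpairP=> h -> <-; rewrite lractA bpairMl.
Qed.

Lemma bcomp_ractE y x g : bcomp_ract (bpair y x) g = bpair y (x >* g).
Proof.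
rewrite /bcomp_ract; case E: (qrepr _) => [y' x'] /=.
have: bpair y' x' = bpair y x by rewrite {1}/bpair -E reprK.
by case/bpairP=> h -> <-; rewrite bpairMl lractA.
Qed.

Definition bcomp_act : biact K G bcomp_car.
Proof.
exists bcomp_lact bcomp_ract.
- by elim/bcomp_ind=> y x; rewrite bcomp_lactE lact1.
- by move=> a b; elim/bcomp_ind=> y x; rewrite !bcomp_lactE lactM.
- by elim/bcomp_ind=> y x; rewrite bcomp_ractE ract1.
- by elim/bcomp_ind=> y x a b; rewrite !bcomp_ractE ractM.
- by move=> k; elim/bcomp_ind=> y x g; rewrite !(bcomp_lactE, bcomp_ractE).
Defined.
Definition bcomp : biset K G := Biset bcomp_act.

Lemma bcomp_biso (Z : biset K G) (f : Y -> X -> Z) :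
  (forall y h x, f (y >* h) x = f y (h *< x)) ->
  (forall y x y' x', f y x = f y' x' -> bpair y x = bpair y' x') ->
  (forall z, exists y x, f y x = z) ->
  (forall k y x, f (k *< y) x = k *< f y x) ->
  (forall y x g, f y (x >* g) = f y x >* g) ->
  biso bcomp Z.
Proof.
move=> fb fi fs fl fr; pose F (z : bcomp) : Z := f (qrepr z).1 (qrepr z).2.
have FE y x : F (bpair y x) = f y x.
  rewrite /F; case E: (qrepr _) => [y' x'] /=.
  have: bpair y' x' = bpair y x by rewrite {1}/bpair -E reprK.
  by case/bpairP=> h -> <-; rewrite fb.
exists F; split.
- apply: inj_surj_bij.
    elim/bcomp_ind=> y x; elim/bcomp_ind=> y' x'; rewrite !FE; exact: fi.
  by move=> z; have [y [x <-]] := fs z; exists (bpair y x).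
- by move=> k; elim/bcomp_ind=> y x; rewrite /lact /= bcomp_lactE !FE.
- by elim/bcomp_ind=> y x g; rewrite /ract /= bcomp_ractE !FE.
Qed.
End Composition.

Section CompositionTheory.
Variables K H G : finGroupType.
Implicit Types (Y : biset K H) (X : biset H G).

Lemma bcomp_isoE Y Y' X X' : biso Y Y' -> biso X X' ->
  biso (bcomp Y X) (bcomp Y' X').
Proof.
case=> f [[f' fK f'K] fl fr] [g [[g' gK g'K] gl gr]].
apply: (@bcomp_biso _ _ _ _ _ (bcomp Y' X') (fun y x => bpair (f y) (g x))).
- by move=> y h x; rewrite fr gl bpairMl.
- move=> y x y' x' /bpairP[h e1 e2]; apply/bpairP; exists h.
    by apply: (can_inj fK); rewrite fr.
  by apply: (can_inj gK); rewrite gl.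
- by elim/bcomp_ind=> y x; exists (f' y), (g' x); rewrite f'K g'K.
- by move=> k y x; rewrite fl /lact /= bcomp_lactE.
- by move=> y x a; rewrite gr /ract /= bcomp_ractE.
Qed.

Lemma bcomp_suml Y1 Y2 X :
  biso (bcomp (bsum Y1 Y2) X) (bsum (bcomp Y1 X) (bcomp Y2 X)).
Proof.
pose f (y : bsum Y1 Y2) (x : X) : bsum (bcomp Y1 X) (bcomp Y2 X) :=
  match y with inl y1 => inl (bpair y1 x) | inr y2 => inr (bpair y2 x) end.
apply: (@bcomp_biso _ _ _ _ _ _ f).
- by case=> y h x; [apply: (congr1 inl) | apply: (congr1 inr)]; apply: bpairMl.
- by case=> y x [] y' x' //= [] /bpairP[h -> <-]; apply/bpairP; exists h.
- by case; elim/bcomp_ind=> y x; [exists (inl y), x | exists (inr y), x].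
- by move=> k [] y x; rewrite /lact /= /lact /= bcomp_lactE.
- by case=> y x g; rewrite /ract /= /ract /= bcomp_ractE.
Qed.

Lemma bcomp_sumr Y X1 X2 :
  biso (bcomp Y (bsum X1 X2)) (bsum (bcomp Y X1) (bcomp Y X2)).
Proof.
pose f (y : Y) (x : bsum X1 X2) : bsum (bcomp Y X1) (bcomp Y X2) :=
  match x with inl x1 => inl (bpair y x1) | inr x2 => inr (bpair y x2) end.
apply: (@bcomp_biso _ _ _ _ _ _ f).
- by move=> y h [] x; [apply: (congr1 inl) | apply: (congr1 inr)]; apply: bpairMl.
- by move=> y [] x y' [] x' //= [] /bpairP[h -> <-]; apply/bpairP; exists h.
- by case; elim/bcomp_ind=> y x; [exists y, (inl x) | exists y, (inr x)].
- by move=> k y [] x; rewrite /lact /= /lact /= bcomp_lactE.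
- by move=> y [] x g; rewrite /ract /= /ract /= bcomp_ractE.
Qed.

Lemma bcomp_emptyl X : biso (bcomp (bempty K H) X) (bempty K G).
Proof.
pose f (y : bempty K H) (_ : X) : bempty K G := match y with end.
by apply: (@bcomp_biso _ _ _ _ _ _ f) => [[]|[]|[]|k []|[]].
Qed.

Lemma bcomp_emptyr Y : biso (bcomp Y (bempty H G)) (bempty K G).
Proof.
pose f (_ : Y) (x : bempty H G) : bempty K G := match x with end.
by apply: (@bcomp_biso _ _ _ _ _ _ f) => [y h []|y []|[]|k y []|y []].
Qed.

End CompositionTheory.

Section SumTheory.
Variables H G : finGroupType.
Implicit Types X Y Z : biset H G.

Lemma bsum_iso X X' Y Y' : biso X X' -> biso Y Y' ->
  biso (bsum X Y) (bsum X' Y').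
Proof.
case=> f [[f' fK f'K] fl fr] [g [[g' gK g'K] gl gr]].
exists (fun z => match z with inl x => inl (f x) | inr y => inr (g y) end).
split.
- exists (fun z => match z with inl x => inl (f' x) | inr y => inr (g' y) end).
    by case=> x; rewrite ?fK ?gK.
  by case=> x; rewrite ?f'K ?g'K.
- by move=> h [] x; congr (_ _); [apply: fl | apply: gl].
- by move=> [] x a; congr (_ _); [apply: fr | apply: gr].
Qed.

Lemma bsumA X Y Z : biso (bsum X (bsum Y Z)) (bsum (bsum X Y) Z).
Proof.
exists (fun t => match t with inl x => inl (inl x)
  | inr (inl y) => inl (inr y) | inr (inr z) => inr z end).
split; last 2 first.
- by move=> h [|[]].
- by move=> [|[]].
exists (fun t => match t with inl (inl x) => inl x
  | inl (inr y) => inr (inl y) | inr z => inr (inr z) end).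
  by case=> [|[]].
by case=> [[]|].
Qed.

Lemma bsumC X Y : biso (bsum X Y) (bsum Y X).
Proof.
exists (fun t => match t with inl x => inr x | inr y => inl y end).
split; last 2 first.
- by move=> h [].
- by case.
by exists (fun t => match t with inl x => inr x | inr y => inl y end); case.
Qed.

Lemma bsum0 X : biso (bsum (bempty H G) X) X.
Proof.
exists (fun t => match t with inl v => match (v : void) with end | inr x => x end).
split; last 2 first.
- by move=> h [].
- by case.
by exists inr => [[]|x].
Qed.

End SumTheory.

Section Grothendieck.
Variable V : nmodType.

Definition groth_rel (p q : V * V) : bool :=
  `[< exists z, p.1 + q.2 + z = q.1 + p.2 + z >].

Lemma groth_rel_equiv : equiv_class_of groth_rel.
Proof.
split.
- by move=> p; apply/asboolP; exists 0.
- have sym p q : groth_rel p q -> groth_rel q p.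
    by case/asboolP=> z e; apply/asboolP; exists z.
  by move=> p q; apply/idP/idP; apply: sym.
- move=> q p r /asboolP[z e] /asboolP[z' e']; apply/asboolP.
  exists (q.1 + q.2 + z + z').
  rewrite [LHS](AC (2*4) ((1*4*5)*(3*2*6))) /= e e'.
  by rewrite [LHS](AC (3*3) ((4*2)*(1*5*3*6))).
Qed.
Canonical groth_equiv_rel := EquivRelPack groth_rel_equiv.

Definition groth : Type := {eq_quot groth_rel}.
HB.instance Definition _ := EqQuotient.on groth.
HB.instance Definition _ := Choice.on groth.

Definition gdiff (u v : V) : groth := \pi_groth (u, v).

Lemma gdiffP u v u' v' :
  gdiff u v = gdiff u' v' <-> exists z, u + v' + z = u' + v + z.
Proof.
by split=> [/eqquotP/asboolP | e]; last apply/eqquotP/asboolP.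
Qed.

Lemma groth_ind (P : groth -> Prop) :
  (forall u v, P (gdiff u v)) -> forall x, P x.
Proof. by move=> IH x; rewrite -[x]reprK; case: (qrepr x). Qed.

Lemma groth_reprP u v (p := qrepr (gdiff u v)) :
  exists z, p.1 + v + z = u + p.2 + z.
Proof. by apply/gdiffP; rewrite /gdiff /p -surjective_pairing reprK. Qed.

Definition groth_zero := gdiff 0 0.
Definition groth_add (x y : groth) :=
  gdiff ((qrepr x).1 + (qrepr y).1) ((qrepr x).2 + (qrepr y).2).
Definition groth_opp (x : groth) := gdiff (qrepr x).2 (qrepr x).1.

Lemma groth_addE u v u' v' :
  groth_add (gdiff u v) (gdiff u' v') = gdiff (u + u') (v + v').
Proof.
have [z ez] := groth_reprP u v; have [z' ez'] := groth_reprP u' v'.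
apply/gdiffP; exists (z + z').
rewrite [LHS](AC (2*2*2) ((1*3*5)*(2*4*6))) /= ez ez'.
by rewrite [LHS](AC (3*3) ((1*4)*(2*5)*(3*6))).
Qed.

Lemma groth_oppE u v : groth_opp (gdiff u v) = gdiff v u.
Proof.
have [z ez] := groth_reprP u v; apply/gdiffP; exists z.
by rewrite [_ + u]addrC [v + _]addrC ez.
Qed.

Lemma groth_addA : associative groth_add.
Proof.
by elim/groth_ind=> ? ?; elim/groth_ind=> ? ?; elim/groth_ind=> ? ?;
   rewrite !groth_addE !addrA.
Qed.
Lemma groth_addC : commutative groth_add.
Proof.
elim/groth_ind=> u v; elim/groth_ind=> u' v'.
by rewrite !groth_addE [u + _]addrC [v + _]addrC.
Qed.
Lemma groth_add0 : left_id groth_zero groth_add.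
Proof. by elim/groth_ind=> u v; rewrite groth_addE !add0r. Qed.
Lemma groth_addN : left_inverse groth_zero groth_opp groth_add.
Proof.
elim/groth_ind=> u v; rewrite groth_oppE groth_addE; apply/gdiffP; exists 0.
by rewrite [v + u]addrC !addr0 add0r.
Qed.
HB.instance Definition _ :=
  GRing.isZmodule.Build groth groth_addA groth_addC groth_add0 groth_addN.

Definition to_groth (v : V) : groth := gdiff v 0.

Lemma to_grothD u v : to_groth (u + v) = to_groth u + to_groth v.
Proof. by rewrite [RHS]groth_addE addr0. Qed.

Lemma to_groth0 : to_groth 0 = 0. Proof. by []. Qed.

Lemma gdiffE u v : gdiff u v = to_groth u - to_groth v.
Proof. by rewrite /to_groth [- _]groth_oppE [RHS]groth_addE addr0 add0r. Qed.

End Grothendieck.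

Section GrothendieckBilinear.
Variables (V W U : nmodType) (f : V -> W -> U).
Hypothesis fDl : forall v v' w, f (v + v') w = f v w + f v' w.
Hypothesis fDr : forall v w w', f v (w + w') = f v w + f v w'.

Definition groth_map2 (x : groth V) (y : groth W) : groth U :=
  let p := qrepr x in let q := qrepr y in
  to_groth (f p.1 q.1) - to_groth (f p.1 q.2)
  - (to_groth (f p.2 q.1) - to_groth (f p.2 q.2)).

Lemma groth_map2E u v u' v' : groth_map2 (gdiff u v) (gdiff u' v') =
  to_groth (f u u') - to_groth (f u v') - (to_groth (f v u') - to_groth (f v v')).
Proof.
rewrite /groth_map2; set p := qrepr _; set q := qrepr _.
have [z ez] := groth_reprP u v; rewrite -/p in ez.
have [z' ez'] := groth_reprP u' v'; rewrite -/q in ez'.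
pose tf a b := to_groth (f a b).
have tDl a a' b : tf (a + a') b = tf a b + tf a' b by rewrite /tf fDl to_grothD.
have tDr a b b' : tf a (b + b') = tf a b + tf a b' by rewrite /tf fDr to_grothD.
have el b : tf p.1 b - tf p.2 b = tf u b - tf v b.
  have := congr1 (tf^~ b) ez; rewrite !tDl => /addIr e.
  by apply/eqP; rewrite subr_eq addrAC -e addrK.
have er a : tf a q.1 - tf a q.2 = tf a u' - tf a v'.
  have := congr1 (tf a) ez'; rewrite !tDr => /addIr e.
  by apply/eqP; rewrite subr_eq addrAC -e addrK.
rewrite -!/(tf _ _) !er.
have shuf (a b c d : groth U) : a - b - (c - d) = (a - c) - (b - d).
  by rewrite !opprB [LHS](AC (2*2) ((1*4)*(3*2))).
by rewrite shuf !el -shuf.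
Qed.

Lemma groth_map2_class v w :
  groth_map2 (to_groth v) (to_groth w) = to_groth (f v w).
Proof.
have f0l b : to_groth (f 0 b) = 0.
  by have := congr1 (@to_groth U) (fDl 0 0 b);
     rewrite addr0 to_grothD -{1}[to_groth _]addr0 => /addrI.
have f0r a : to_groth (f a 0) = 0.
  by have := congr1 (@to_groth U) (fDr a 0 0);
     rewrite addr0 to_grothD -{1}[to_groth _]addr0 => /addrI.
by rewrite groth_map2E f0r !f0l !subr0.
Qed.

Lemma groth_map2Dl x x' y : groth_map2 (x + x') y = groth_map2 x y + groth_map2 x' y.
Proof.
elim/groth_ind: x => u v; elim/groth_ind: x' => u' v'; elim/groth_ind: y => s t.
rewrite [X in groth_map2 X _]groth_addE !groth_map2E !fDl !to_grothD.
rewrite !opprD !opprK.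
by rewrite [LHS](AC ((2*2)*(2*2)) (((1*3)*(5*7))*((2*4)*(6*8)))).
Qed.

Lemma groth_map2Dr x y y' : groth_map2 x (y + y') = groth_map2 x y + groth_map2 x y'.
Proof.
elim/groth_ind: x => u v; elim/groth_ind: y => s t; elim/groth_ind: y' => s' t'.
rewrite [X in groth_map2 _ X]groth_addE !groth_map2E !fDr !to_grothD.
rewrite !opprD !opprK.
by rewrite [LHS](AC ((2*2)*(2*2)) (((1*3)*(5*7))*((2*4)*(6*8)))).
Qed.

End GrothendieckBilinear.

(* [tens k V] is the tensor product of k and V over the integers: formal sums of
   pure tensors modulo biadditivity.  As formal sums only form a monoid, (0, v)
   has to be identified with 0 explicitly. *)

Section Extension.
Variables (k : comPzRingType) (V : zmodType).

Inductive tens_eq : seq (k * V) -> seq (k * V) -> Prop :=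
| tens_refl s : tens_eq s s
| tens_sym s t : tens_eq s t -> tens_eq t s
| tens_trans s t u : tens_eq s t -> tens_eq t u -> tens_eq s u
| tens_cat s s' t t' : tens_eq s s' -> tens_eq t t' -> tens_eq (s ++ t) (s' ++ t')
| tens_catC s t : tens_eq (s ++ t) (t ++ s)
| tens_addl a b v : tens_eq [:: (a + b, v)] [:: (a, v); (b, v)]
| tens_addr a v w : tens_eq [:: (a, v + w)] [:: (a, v); (a, w)]
| tens_zero v : tens_eq [:: (0, v)] [::].

Definition tens_rel s t : bool := `[< tens_eq s t >].

Lemma tens_rel_equiv : equiv_class_of tens_rel.
Proof.
split.
- by move=> s; apply/asboolP/tens_refl.
- by move=> s t; apply/asboolP/asboolP; apply: tens_sym.
- by move=> t s u /asboolP e /asboolP e'; apply/asboolP/(tens_trans e e').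
Qed.
Canonical tens_equiv_rel := EquivRelPack tens_rel_equiv.

Definition tens : Type := {eq_quot tens_rel}.
HB.instance Definition _ := EqQuotient.on tens.
HB.instance Definition _ := Choice.on tens.

Definition tsum (s : seq (k * V)) : tens := \pi_tens s.

Lemma tsumP s t : tsum s = tsum t <-> tens_eq s t.
Proof. by split=> [/eqquotP/asboolP | e]; last apply/eqquotP/asboolP. Qed.

Lemma tens_ind_sum (P : tens -> Prop) :
  (forall s, P (tsum s)) -> forall x, P x.
Proof. by move=> IH x; rewrite -[x]reprK; apply: IH. Qed.

Lemma tens_reprP s : tens_eq (qrepr (tsum s)) s.
Proof. by apply/tsumP; rewrite /tsum reprK. Qed.

Definition tens_scale (c : k) (x : tens) : tens :=
  tsum [seq (c * p.1, p.2) | p <- qrepr x].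
Definition tens_add (x y : tens) : tens := tsum (qrepr x ++ qrepr y).
Definition tens_opp (x : tens) : tens := tens_scale (- 1) x.

Lemma tens_addE s t : tens_add (tsum s) (tsum t) = tsum (s ++ t).
Proof. by apply/tsumP/tens_cat; apply: tens_reprP. Qed.

Lemma tens_scaleE c s : tens_scale c (tsum s) = tsum [seq (c * p.1, p.2) | p <- s].
Proof.
apply/tsumP; move: (qrepr _) (tens_reprP s) => s0; elim=> {s s0} //=.
- by move=> s; apply: tens_refl.
- by move=> s' t _; apply: tens_sym.
- by move=> s' t u _ e _ e'; apply: tens_trans e e'.
- by move=> s' s'' t t' _ e _ e'; rewrite !map_cat; apply: tens_cat.
- by move=> s' t; rewrite !map_cat; apply: tens_catC.
- by move=> a b v; rewrite mulrDr; apply: tens_addl.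
- by move=> a v w; apply: tens_addr.
- by move=> v; rewrite mulr0; apply: tens_zero.
Qed.

Lemma tens_addA : associative tens_add.
Proof.
by elim/tens_ind_sum=> ?; elim/tens_ind_sum=> ?; elim/tens_ind_sum=> ?;
   rewrite !tens_addE catA.
Qed.
Lemma tens_addC : commutative tens_add.
Proof.
elim/tens_ind_sum=> s; elim/tens_ind_sum=> t; rewrite !tens_addE.
exact/tsumP/tens_catC.
Qed.
Lemma tens_add0 : left_id (tsum [::]) tens_add.
Proof. by elim/tens_ind_sum=> s; rewrite tens_addE. Qed.

Lemma tens_scaleDl c x d :
  tens_scale (c + d) x = tens_add (tens_scale c x) (tens_scale d x).
Proof.
elim/tens_ind_sum: x => s; rewrite !tens_scaleE tens_addE; apply/tsumP.
elim: s => [|[a v] s IH] /=; first exact: tens_refl.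
set S1 := map _ s in IH *; set S2 := map _ s in IH *; set S3 := map _ s in IH *.
rewrite mulrDl -cat1s; apply: tens_trans (tens_cat (tens_addl _ _ _) IH) _.
rewrite -[(c * a, v) :: S2 ++ _]/([:: (c * a, v)] ++ _).
rewrite -[_ ++ (S2 ++ S3)]/([:: (c * a, v)] ++ ([:: (d * a, v)] ++ (S2 ++ S3))).
apply: tens_cat; first exact: tens_refl.
rewrite -[_ :: S3]/([:: (d * a, v)] ++ S3) !catA.
by apply: tens_cat; [apply: tens_catC | apply: tens_refl].
Qed.

Lemma tens_scale0 x : tens_scale 0 x = tsum [::].
Proof.
elim/tens_ind_sum: x => s; rewrite tens_scaleE; apply/tsumP.
elim: s => [|[a v] s IH] /=; first exact: tens_refl.
by rewrite mul0r -cat1s -[[::]]cat0s; apply: tens_cat => //; apply: tens_zero.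
Qed.

Lemma tens_scale1 : left_id 1 tens_scale.
Proof.
elim/tens_ind_sum=> s; rewrite tens_scaleE -[in RHS](map_id s).
by congr tsum; apply: eq_map => -[a v] /=; rewrite mul1r.
Qed.

Lemma tens_addN : left_inverse (tsum [::]) tens_opp tens_add.
Proof.
move=> x; rewrite -{2}[x]tens_scale1 /tens_opp -tens_scaleDl addNr.
exact: tens_scale0.
Qed.
HB.instance Definition _ :=
  GRing.isZmodule.Build tens tens_addA tens_addC tens_add0 tens_addN.

Lemma tens_scaleA c d x : tens_scale c (tens_scale d x) = tens_scale (c * d) x.
Proof.
elim/tens_ind_sum: x => s; rewrite !tens_scaleE -map_comp; congr tsum.
by apply: eq_map => -[a v] /=; rewrite mulrA.
Qed.
Lemma tens_scaleDr : right_distributive tens_scale +%R.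
Proof.
move=> c; elim/tens_ind_sum=> s; elim/tens_ind_sum=> t.
by rewrite [s in tens_scale _ s]tens_addE !tens_scaleE [RHS]tens_addE map_cat.
Qed.
Lemma tens_scaleDl' x : {morph tens_scale^~ x : c d / c + d}.
Proof. by move=> c d; apply: tens_scaleDl. Qed.
HB.instance Definition _ := GRing.Zmodule_isLmodule.Build k tens
  tens_scaleA tens_scale1 tens_scaleDr tens_scaleDl'.

Definition pure (v : V) : tens := tsum [:: (1, v)].

Lemma pureD v w : pure (v + w) = pure v + pure w.
Proof. by rewrite [RHS]tens_addE; apply/tsumP/tens_addr. Qed.

Lemma pure0 : pure 0 = 0.
Proof. by have := pureD 0 0; rewrite addr0 -{1}[pure _]addr0 => /addrI. Qed.

Lemma tsumE s : tsum s = \sum_(p <- s) p.1 *: pure p.2.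
Proof.
elim: s => [|[a v] s IH]; first by rewrite big_nil.
rewrite big_cons -IH [pure _]/pure [_ *: _]tens_scaleE /= mulr1.
by rewrite [RHS]tens_addE.
Qed.

Lemma tens_reprE x : x = \sum_(p <- qrepr x) p.1 *: pure p.2.
Proof. by rewrite -tsumE /tsum reprK. Qed.

Lemma tens_sum_eq (M : lmodType k) (f : V -> M) s t :
  (forall v w, f (v + w) = f v + f w) -> tens_eq s t ->
  \sum_(p <- s) p.1 *: f p.2 = \sum_(p <- t) p.1 *: f p.2.
Proof.
move=> fD; elim=> {s t} //.
- by move=> s t u _ -> _ ->.
- by move=> s s' t t' _ e _ e'; rewrite !big_cat /= e e'.
- by move=> s t; rewrite !big_cat /= addrC.
- by move=> a b v; rewrite !big_cons big_nil !addr0 scalerDl.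
- by move=> a v w; rewrite !big_cons big_nil !addr0 fD scalerDr.
- by move=> v; rewrite big_cons !big_nil scale0r addr0.
Qed.

End Extension.

Section ExtensionBilinear.
Variables (k : comPzRingType) (V W U : zmodType) (f : V -> W -> U).
Hypothesis fDl : forall v v' w, f (v + v') w = f v w + f v' w.
Hypothesis fDr : forall v w w', f v (w + w') = f v w + f v w'.

Definition tens_map2 (x : tens k V) (y : tens k W) : tens k U :=
  \sum_(p <- qrepr x) p.1 *: \sum_(q <- qrepr y) q.1 *: pure k (f p.2 q.2).

Lemma tens_map2E s t : tens_map2 (tsum s) (tsum t) =
  \sum_(p <- s) p.1 *: \sum_(q <- t) q.1 *: pure k (f p.2 q.2).
Proof.
rewrite /tens_map2.
have e v : \sum_(q <- qrepr (tsum t)) q.1 *: pure k (f v q.2) =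
           \sum_(q <- t) q.1 *: pure k (f v q.2).
  apply: (@tens_sum_eq k W (tens k U) (fun w => pure k (f v w))).
    by move=> w w'; rewrite fDr pureD.
  exact: tens_reprP.
under eq_bigr do rewrite e.
apply: (@tens_sum_eq k V _ (fun v => \sum_(q <- t) q.1 *: pure k (f v q.2))).
  move=> v v'; rewrite -big_split /=; apply: eq_bigr => q _.
  by rewrite fDl pureD scalerDr.
exact: tens_reprP.
Qed.

Lemma tens_map2_pure v w : tens_map2 (pure k v) (pure k w) = pure k (f v w).
Proof. by rewrite tens_map2E !big_seq1 !scale1r. Qed.

Lemma tens_map2_linl c x x' y :
  tens_map2 (c *: x + x') y = c *: tens_map2 x y + tens_map2 x' y.
Proof.
elim/tens_ind_sum: x => s; elim/tens_ind_sum: x' => s'; elim/tens_ind_sum: y => t.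
rewrite [c *: tsum s]tens_scaleE [in LHS]/+%R /= tens_addE !tens_map2E big_cat big_map /=.
by rewrite scaler_sumr; congr (_ + _); apply: eq_bigr => p _; rewrite scalerA.
Qed.

Lemma tens_map2_linr c x y y' :
  tens_map2 x (c *: y + y') = c *: tens_map2 x y + tens_map2 x y'.
Proof.
elim/tens_ind_sum: x => s; elim/tens_ind_sum: y => t; elim/tens_ind_sum: y' => t'.
rewrite [c *: tsum t]tens_scaleE [in LHS]/+%R /= tens_addE !tens_map2E.
rewrite scaler_sumr -big_split /=; apply: eq_bigr => p _.
rewrite big_cat big_map /= scalerDr; congr (_ + _).
rewrite scalerA [c * _]mulrC -scalerA [c *: \sum_(_ <- _) _]scaler_sumr; congr (p.1 *: _).
by apply: eq_bigr => q _; rewrite scalerA.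
Qed.

End ExtensionBilinear.

(* Isomorphism classes of finite bisets.  Every finite biset is isomorphic to
   one carried by some 'I_n; restricting to these keeps the type of classes in
   the universe of finite groups. *)

Section BisetClasses.
Variables H G : finGroupType.

Definition sbiset := {classic {n : nat & biact H G 'I_n}}.
Definition biset_of_small (X : sbiset) : biset H G :=
  @Biset H G 'I_(projT1 X) (projT2 X).

Section Shrink.
Variable X : biset H G.
Definition shrink_lact h (i : 'I_#|X|) := enum_rank (h *< (enum_val i : X)).
Definition shrink_ract (i : 'I_#|X|) g := enum_rank ((enum_val i : X) >* g).
Definition shrink_act : biact H G 'I_#|X|.
Proof.
exists shrink_lact shrink_ract; rewrite /shrink_lact /shrink_ract.
- by move=> x; rewrite lact1 enum_valK.
- by move=> a b x; rewrite enum_rankK lactM.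
- by move=> x; rewrite ract1 enum_valK.
- by move=> x a b; rewrite enum_rankK ractM.
- by move=> h x g; rewrite !enum_rankK lractA.
Defined.
Definition shrink : sbiset := existT _ #|X| shrink_act.

Lemma shrink_iso : biso X (biset_of_small shrink).
Proof.
exists (@enum_rank X); split.
- exact: enum_rank_bij.
- by move=> h x; rewrite /lact /= /shrink_lact enum_rankK.
- by move=> x g; rewrite /ract /= /shrink_ract enum_rankK.
Qed.
End Shrink.

Definition sbiso (X Y : sbiset) : bool :=
  `[< biso (biset_of_small X) (biset_of_small Y) >].

Lemma sbiso_equiv : equiv_class_of sbiso.
Proof.
split.
- by move=> X; apply/asboolP/biso_refl.
- by move=> X Y; apply/asboolP/asboolP; apply: biso_sym.
- by move=> Y X Z /asboolP e /asboolP e'; apply/asboolP/(biso_trans e e').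
Qed.
Canonical sbiso_equiv_rel := EquivRelPack sbiso_equiv.

Definition bclass : Type := {eq_quot sbiso}.
HB.instance Definition _ := EqQuotient.on bclass.
HB.instance Definition _ := Choice.on bclass.

Definition class_of (X : biset H G) : bclass := \pi_bclass (shrink X).
Definition rep_of (c : bclass) : biset H G := biset_of_small (qrepr c).

Lemma class_ofP X Y : class_of X = class_of Y <-> biso X Y.
Proof.
split=> [/eqquotP/asboolP e | e].
  exact: biso_trans (shrink_iso X) (biso_trans e (biso_sym (shrink_iso Y))).
apply/eqquotP/asboolP.
exact: biso_trans (biso_sym (shrink_iso X)) (biso_trans e (shrink_iso Y)).
Qed.

Lemma rep_ofK c : class_of (rep_of c) = c.
Proof.
rewrite -[c in RHS]reprK; apply/eqquotP/asboolP.
exact/biso_sym/shrink_iso.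
Qed.

Lemma class_ind (P : bclass -> Prop) :
  (forall X, P (class_of X)) -> forall c, P c.
Proof. by move=> IH c; rewrite -[c]rep_ofK. Qed.

Lemma rep_of_iso X : biso (rep_of (class_of X)) X.
Proof. by apply/class_ofP; rewrite rep_ofK. Qed.

Definition bclass_add (c d : bclass) := class_of (bsum (rep_of c) (rep_of d)).

Lemma bclass_addE X Y :
  bclass_add (class_of X) (class_of Y) = class_of (bsum X Y).
Proof. by apply/class_ofP/bsum_iso; apply: rep_of_iso. Qed.

Lemma bclass_addA : associative bclass_add.
Proof.
by elim/class_ind=> X; elim/class_ind=> Y; elim/class_ind=> Z;
   rewrite !bclass_addE; apply/class_ofP/bsumA.
Qed.
Lemma bclass_addC : commutative bclass_add.
Proof.
by elim/class_ind=> X; elim/class_ind=> Y;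
   rewrite !bclass_addE; apply/class_ofP/bsumC.
Qed.
Lemma bclass_add0 : left_id (class_of (bempty H G)) bclass_add.
Proof. by elim/class_ind=> X; rewrite bclass_addE; apply/class_ofP/bsum0. Qed.
HB.instance Definition _ :=
  GRing.isNmodule.Build bclass bclass_addA bclass_addC bclass_add0.

End BisetClasses.

Section ClassComposition.
Variables K H G : finGroupType.

Definition class_comp (d : bclass K H) (c : bclass H G) : bclass K G :=
  class_of (bcomp (rep_of d) (rep_of c)).

Lemma class_compE (Y : biset K H) (X : biset H G) :
  class_comp (class_of Y) (class_of X) = class_of (bcomp Y X).
Proof. by apply/class_ofP/bcomp_isoE; apply: rep_of_iso. Qed.

Lemma class_compDl d d' c :
  class_comp (d + d') c = class_comp d c + class_comp d' c.
Proof.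
elim/class_ind: d => Y; elim/class_ind: d' => Y'; elim/class_ind: c => X.
rewrite [X in class_comp X _]bclass_addE !class_compE [RHS]bclass_addE.
exact/class_ofP/bcomp_suml.
Qed.

Lemma class_compDr d c c' :
  class_comp d (c + c') = class_comp d c + class_comp d c'.
Proof.
elim/class_ind: d => Y; elim/class_ind: c => X; elim/class_ind: c' => X'.
rewrite [X in class_comp _ X]bclass_addE !class_compE [RHS]bclass_addE.
exact/class_ofP/bcomp_sumr.
Qed.

End ClassComposition.

Definition burnside (H G : finGroupType) : zmodType := groth (bclass H G).
Definition burnk (k : comPzRingType) (H G : finGroupType) : lmodType k :=
  tens k (burnside H G).

Definition burnside_comp (K H G : finGroupType)
    (y : burnside K H) (x : burnside H G) : burnside K G :=
  groth_map2 (@class_comp K H G) y x.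

Definition burnk_comp (k : comPzRingType) (K H G : finGroupType)
    (y : burnk k K H) (x : burnk k H G) : burnk k K G :=
  tens_map2 (@burnside_comp K H G) y x.

Definition bcls (H G : finGroupType) (X : biset H G) : burnside H G :=
  to_groth (class_of X).
Definition bclsk (k : comPzRingType) (H G : finGroupType) (X : biset H G) :
  burnk k H G := pure k (bcls X).

Section BurnsideTheory.
Variables K H G : finGroupType.

Lemma bcls_iso (X Y : biset H G) : biso X Y -> bcls X = bcls Y.
Proof. by move=> e; congr to_groth; apply/class_ofP. Qed.

Lemma bcls_sum (X Y : biset H G) : bcls (bsum X Y) = bcls X + bcls Y.
Proof. by rewrite -to_grothD /bcls [_ + _ in RHS]bclass_addE. Qed.

Lemma burnside_comp_cls (Y : biset K H) (X : biset H G) :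
  burnside_comp (bcls Y) (bcls X) = bcls (bcomp Y X).
Proof.
rewrite /burnside_comp groth_map2_class ?class_compE //.
  exact: class_compDl.
exact: class_compDr.
Qed.

Lemma burnside_compDl (y y' : burnside K H) (x : burnside H G) :
  burnside_comp (y + y') x = burnside_comp y x + burnside_comp y' x.
Proof. by apply: groth_map2Dl; [apply: class_compDl | apply: class_compDr]. Qed.

Lemma burnside_compDr (y : burnside K H) (x x' : burnside H G) :
  burnside_comp y (x + x') = burnside_comp y x + burnside_comp y x'.
Proof. by apply: groth_map2Dr; [apply: class_compDl | apply: class_compDr]. Qed.

Lemma burnside_gen (x : burnside H G) :
  exists X Y : biset H G, x = bcls X - bcls Y.
Proof.
elim/groth_ind: x => u v; exists (rep_of u), (rep_of v).
by rewrite gdiffE /bcls !rep_ofK.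
Qed.

Variable k : comPzRingType.

Lemma bclsk_iso (X Y : biset H G) : biso X Y -> bclsk k X = bclsk k Y.
Proof. by move=> e; congr pure; apply: bcls_iso. Qed.

Lemma bclsk_sum (X Y : biset H G) :
  bclsk k (bsum X Y) = bclsk k X + bclsk k Y.
Proof. by rewrite /bclsk bcls_sum pureD. Qed.

Lemma burnk_comp_cls (Y : biset K H) (X : biset H G) :
  burnk_comp (bclsk k Y) (bclsk k X) = bclsk k (bcomp Y X).
Proof.
rewrite /burnk_comp tens_map2_pure ?burnside_comp_cls //.
  exact: burnside_compDl.
exact: burnside_compDr.
Qed.

Lemma burnk_comp_linl c (y y' : burnk k K H) (x : burnk k H G) :
  burnk_comp (c *: y + y') x = c *: burnk_comp y x + burnk_comp y' x.
Proof. by apply: tens_map2_linl; [apply: burnside_compDl | apply: burnside_compDr]. Qed.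

Lemma burnk_comp_linr c (y : burnk k K H) (x x' : burnk k H G) :
  burnk_comp y (c *: x + x') = c *: burnk_comp y x + burnk_comp y x'.
Proof. by apply: tens_map2_linr; [apply: burnside_compDl | apply: burnside_compDr]. Qed.

End BurnsideTheory.

Section SpecialBisets.
Variables K H G : finGroupType.

Definition breg_act : biact G G G :=
  @Biact G G G (fun a x => a * x)%g (fun x b => x * b)%g
    (@mul1g _) (fun a b x => esym (mulgA a b x))
    (@mulg1 _) (@mulgA _) (@mulgA _).
Definition breg : biset G G := Biset breg_act.

Variable phi : hom G H.

Definition Ind_act : biact H G H.
Proof.
exists (fun h x => h * x)%g (fun x g => x * phi g)%g.
- exact: mul1g.
- by move=> a b x; rewrite mulgA.
- by move=> x; rewrite hom1 mulg1.
- by move=> x a b; rewrite homM mulgA.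
- by move=> h x g; rewrite mulgA.
Defined.
Definition Ind : biset H G := Biset Ind_act.

Definition Res_act : biact G H H.
Proof.
exists (fun g x => phi g * x)%g (fun x h => x * h)%g.
- by move=> x; rewrite hom1 mul1g.
- by move=> a b x; rewrite homM mulgA.
- exact: mulg1.
- exact: mulgA.
- by move=> h x g; rewrite mulgA.
Defined.
Definition Res : biset G H := Biset Res_act.

(* G with (a, b) x = a x b^-1, the (G x G, 1)-biset whose image of 1 is the
   identity of G in P_A *)
Definition diag_act : biact (G * G)%type unit G.
Proof.
exists (fun (p : G * G) x => p.1 * x * p.2^-1)%g (fun x _ => x) => //.
- by move=> x; rewrite mul1g invg1 mulg1.
- by move=> [a1 a2] [b1 b2] x /=; rewrite invMg !mulgA.
Defined.
Definition diag : biset (G * G)%type unit := Biset diag_act.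

(* K x H x G with the middle factor acted on as h1^-1 h h2 *)
Definition contract_lact (p : K * G) (t : K * H * G) : K * H * G :=
  ((p.1 * t.1.1, t.1.2), p.2 * t.2)%g.
Definition contract_ract (t : K * H * G) (q : (K * H) * (H * G)) : K * H * G :=
  ((t.1.1 * q.1.1, q.1.2^-1 * t.1.2 * q.2.1), t.2 * q.2.2)%g.
Definition contract_act :
  biact (K * G)%type ((K * H) * (H * G))%type (K * H * G)%type.
Proof.
exists contract_lact contract_ract; rewrite /contract_lact /contract_ract.
- by move=> [[a b] c] /=; rewrite !mul1g.
- by move=> [a a'] [b b'] [[x y] z] /=; rewrite !mulgA.
- by move=> [[a b] c] /=; rewrite !mulg1 invg1 mul1g.
- by move=> [[x y] z] [[a b] [c d]] [[a' b'] [c' d']] /=; rewrite invMg !mulgA.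
- by move=> [a a'] [[x y] z] [[b c] [d e]] /=; rewrite !mulgA.
Defined.
Definition contract : biset (K * G)%type ((K * H) * (H * G))%type :=
  Biset contract_act.

End SpecialBisets.

(* Closure under subquotients is understood up to isomorphism, so that the
   trivial group belongs to any nonempty class. *)

Definition subquotient (K G : finGroupType) : Prop :=
  exists M N : {group G}, ((N <| M) /\ ([set: K] \isog M / N))%g.

Record group_class := GroupClass {
  in_class :> finGroupType -> Prop;
  class_nonempty : exists G, in_class G;
  class_subquotient : forall G K : finGroupType,
    in_class G -> subquotient K G -> in_class K;
  class_prod : forall G H : finGroupType,
    in_class G -> in_class H -> in_class (G * H)%type }.

Record obj (D : group_class) := Obj { ogrp :> finGroupType; objP : D ogrp }.

Lemma class_unit (D : group_class) : D unit.
Proof.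
have [G DG] := class_nonempty D; apply: class_subquotient DG _.
exists 1%G, 1%G; split; first exact: normal1.
by apply: trivial_isog; [apply/setP=> -[]; rewrite !inE | apply: quotient1].
Qed.

Definition ounit (D : group_class) : obj D := Obj (class_unit D).
Definition oprod (D : group_class) (G H : obj D) : obj D :=
  Obj (class_prod (objP G) (objP H)).

Record biset_functor (k : comPzRingType) (D : group_class) := BisetFunctor {
  fobj :> obj D -> lmodType k;
  fmap : forall G H : obj D, burnk k H G -> {linear fobj G -> fobj H};
  fmap_linear : forall (G H : obj D) c (x y : burnk k H G) (a : fobj G),
    fmap (c *: x + y) a = c *: fmap x a + fmap y a;
  fmap_id : forall (G : obj D) (a : fobj G), fmap (bclsk k (breg G)) a = a;
  fmap_comp : forall (G H K : obj D) (y : burnk k K H) (x : burnk k H G) a,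
    fmap (burnk_comp y x) a = fmap y (fmap x a) }.

Record nat_trans k D (A C : biset_functor k D) := NatTrans {
  nt_app :> forall G : obj D, {linear A G -> C G};
  nt_nat : forall (G H : obj D) (x : burnk k H G) (a : A G),
    nt_app H (fmap A x a) = fmap C x (nt_app G a) }.

(* MathComp's algType requires 1 != 0, which would
   exclude the zero functor and the zero ring k, so the products are carried
   explicitly.  The data are separated from the axioms, with definitional eta,
   so that the opposite of the opposite is convertible to the original. *)

Local Set Primitive Projections.
Record green_data (k : comPzRingType) (D : group_class) := GreenData {
  gfun :> biset_functor k D;
  gmul : forall G : obj D, gfun G -> gfun G -> gfun G;
  gone : forall G : obj D, gfun G }.
Local Unset Primitive Projections.

Section GreenOps.
Variables (k : comPzRingType) (D : group_class) (A : green_data k D).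

Definition fRes (G H : obj D) (phi : hom G H) : {linear A H -> A G} :=
  fmap A (bclsk k (Res phi)).
Definition fInd (G H : obj D) (phi : hom G H) : {linear A G -> A H} :=
  fmap A (bclsk k (Ind phi)).

Record is_green : Prop := IsGreen {
  gmulA : forall (G : obj D) (a b c : A G), gmul a (gmul b c) = gmul (gmul a b) c;
  gmul1l : forall (G : obj D) (a : A G), gmul (gone A G) a = a;
  gmul1r : forall (G : obj D) (a : A G), gmul a (gone A G) = a;
  gmul_linl : forall (G : obj D) c (a b d : A G),
    gmul (c *: a + b) d = c *: gmul a d + gmul b d;
  gmul_linr : forall (G : obj D) c (a b d : A G),
    gmul d (c *: a + b) = c *: gmul d a + gmul d b;
  gres1 : forall (G H : obj D) (phi : hom G H), fRes phi (gone A H) = gone A G;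
  gresM : forall (G H : obj D) (phi : hom G H) (a b : A H),
    fRes phi (gmul a b) = gmul (fRes phi a) (fRes phi b);
  gfrobl : forall (G H : obj D) (phi : hom G H) (a : A H) (b : A G),
    gmul a (fInd phi b) = fInd phi (gmul (fRes phi a) b);
  gfrobr : forall (G H : obj D) (phi : hom G H) (a : A H) (b : A G),
    gmul (fInd phi b) a = fInd phi (gmul b (fRes phi a)) }.

Definition gcross (G H : obj D) (a : A G) (b : A H) : A (oprod G H) :=
  gmul (@fRes (oprod G H) G (fst_hom G H) a)
       (@fRes (oprod G H) H (snd_hom G H) b).

Definition geps : A (ounit D) := gone A (ounit D).

Definition gop_data : green_data k D :=
  {| gfun := A; gmul := fun G a b => gmul b a; gone := gone A |}.

End GreenOps.

Record green_functor (k : comPzRingType) (D : group_class) := GreenFunctor {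
  gdata :> green_data k D;
  gaxioms : is_green gdata }.

Lemma gop_is_green k D (A : green_data k D) : is_green A -> is_green (gop_data A).
Proof.
case=> mA m1l m1r ml mr r1 rM fl fr; split=> //=.
by move=> G H phi a b; apply: rM.
Qed.

Definition gop k D (A : green_functor k D) : green_functor k D :=
  GreenFunctor (gop_is_green (gaxioms A)).

Record green_mor k D (A C : green_data k D) := GreenMor {
  gm_nat :> nat_trans A C;
  gm_mul : forall (G : obj D) (a b : A G),
    gm_nat G (gmul a b) = gmul (gm_nat G a) (gm_nat G b);
  gm_one : forall G : obj D, gm_nat G (gone A G) = gone C G }.

Definition gmor_op k D (A C : green_data k D) (f : green_mor A C) :
  green_mor (gop_data A) (gop_data C) :=
  @GreenMor k D (gop_data A) (gop_data C) f
    (fun G a b => gm_mul f b a) (gm_one f).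

Definition gmor_eq k D (A C : green_data k D) (f g : green_mor A C) : Prop :=
  forall G : obj D, f G =1 g G.

Definition gmor_inverse k D (A C : green_data k D)
    (f : green_mor A C) (g : green_mor C A) : Prop :=
  forall G : obj D, cancel (f G) (g G) /\ cancel (g G) (f G).

Definition anti_involution k D (A : green_data k D) (s : nat_trans A A) : Prop :=
  (forall (G : obj D) (a : A G), s G (s G a) = a) /\
  (forall (G : obj D) (a b : A G), s G (gmul a b) = gmul (s G b) (s G a)).

(* k-linear categories on a fixed collection of objects and k-linear functors
   between them that are the identity on objects.  Only the data of a category
   are recorded: its laws play no role in the notion of a functor. *)

Local Set Primitive Projections.
Record lincat (k : comPzRingType) (ob : Type) := LinCat {
  lhom : ob -> ob -> lmodType k;
  lcomp : forall X Y Z, lhom Y Z -> lhom X Y -> lhom X Z;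
  lid : forall X, lhom X X }.
Local Unset Primitive Projections.

Section LinCat.
Variables (k : comPzRingType) (ob : Type).
Implicit Types C E F : lincat k ob.

Definition lopp C : lincat k ob :=
  {| lhom := fun X Y => lhom C Y X;
     lcomp := fun X Y Z (u : lhom C Z Y) (v : lhom C Y X) => lcomp v u;
     lid := lid C |}.

Record linfunctor C E := LinFunctor {
  lf_app :> forall X Y, {linear lhom C X Y -> lhom E X Y};
  lf_comp : forall X Y Z (u : lhom C Y Z) (v : lhom C X Y),
    lf_app X Z (lcomp u v) = lcomp (lf_app Y Z u) (lf_app X Y v);
  lf_id : forall X, lf_app X X (lid C X) = lid E X }.

Definition lf_idfun C : linfunctor C C.
Proof. by exists (fun X Y => idfun). Defined.

Definition lf_compose C E F (Psi : linfunctor E F) (Phi : linfunctor C E) :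
  linfunctor C F.
Proof.
exists (fun X Y => Psi X Y \o Phi X Y : {linear _ -> _}).
- by move=> X Y Z u v /=; rewrite !lf_comp.
- by move=> X /=; rewrite !lf_id.
Defined.

Definition lf_op C E (Phi : linfunctor C E) : linfunctor (lopp C) (lopp E) :=
  @LinFunctor (lopp C) (lopp E) (fun X Y => Phi Y X)
    (fun X Y Z u v => lf_comp Phi v u) (lf_id Phi).

Definition lf_eq C E (Phi Psi : linfunctor C E) : Prop :=
  forall X Y, Phi X Y =1 Psi X Y.

End LinCat.

Section PA.
Variables (k : comPzRingType) (D : group_class).

Definition pa_comp (A : green_data k D) (G H K : obj D)
    (alpha : A (oprod K H)) (beta : A (oprod H G)) : A (oprod K G) :=
  @fmap k D A (oprod (oprod K H) (oprod H G)) (oprod K G)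
    (bclsk k (contract K H G)) (gcross alpha beta).

Definition pa_id (A : green_data k D) (G : obj D) : A (oprod G G) :=
  @fmap k D A (ounit D) (oprod G G) (bclsk k (diag G)) (geps A).

Definition PA (A : green_data k D) : lincat k (obj D) :=
  {| lhom := fun G H => A (oprod H G);
     lcomp := fun G H K alpha beta => pa_comp alpha beta;
     lid := pa_id A |}.

End PA.

Section BisetIsos.
Variables K H G : finGroupType.

Lemma Res_comp (phi : hom G H) (psi : hom H K) (chi : hom G K) :
  (forall g, chi g = psi (phi g)) -> biso (bcomp (Res phi) (Res psi)) (Res chi).
Proof.
move=> e; pose f (h : Res phi) (x : Res psi) : Res chi := (psi h * x)%g.
apply: (@bcomp_biso _ _ _ _ _ _ f); rewrite /f /lact /ract /=.
- by move=> h h' x; rewrite homM mulgA.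
- move=> h x h' x' ex; apply/bpairP; exists (h'^-1 * h)%g; rewrite /lact /ract /=.
    by rewrite mulgA mulgV mul1g.
  by rewrite homM morphV ?inE // -mulgA ex mulgA mulVg mul1g.
- by move=> z; exists 1%g, z; rewrite hom1 mul1g.
- by move=> g h x; rewrite homM e mulgA.
- by move=> h x k; rewrite mulgA.
Qed.

Lemma Ind_Res (phi : hom G H) (psi : hom H G) :
  cancel phi psi -> cancel psi phi -> biso (Ind phi) (Res psi).
Proof.
move=> phiK psiK; exists psi; rewrite /lact /ract /=; split.
- by exists phi.
- by move=> h x; rewrite homM.
- by move=> x g; rewrite homM phiK.
Qed.

Lemma Res_id (phi : hom G G) : phi =1 id -> biso (Res phi) (breg G).
Proof.
move=> e; exists id; split=> //; first by exists id.
by move=> h x; rewrite /lact /= e.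
Qed.

Lemma Ind_tau_diag : biso (bcomp (Ind (tau_hom G G)) (diag G)) (diag G).
Proof.
pose f (p : Ind (tau_hom G G)) (x : diag G) : diag G := (p.1 * x^-1 * p.2^-1)%g.
apply: (@bcomp_biso _ _ _ _ _ _ f); rewrite /f /lact /ract /=.
- by move=> [p q] [a b] x /=; rewrite !invMg !invgK !mulgA.
- move=> [p q] x [p' q'] x' /= e; apply/bpairP.
  exists (q'^-1 * q, p'^-1 * p)%g; rewrite /lact /ract /=.
    by congr (_, _); rewrite /= mulgA mulgV mul1g.
  apply: invg_inj; rewrite !invMg !invgK !mulgA.
  have -> : (x'^-1 = p'^-1 * (p' * x'^-1 * q'^-1) * q')%g.
    by rewrite !mulgA mulVg mul1g mulgKV.
  by rewrite -e !mulgA.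
- by move=> z; exists (1, 1)%g, z^-1%g; rewrite /= invgK invg1 mul1g mulg1.
- by move=> [a b] [p q] x /=; rewrite invMg !mulgA.
- by move=> [p q] x u.
Qed.

Definition swap_fun (x : (G * H) * (H * K)) : (K * H) * (H * G) :=
  ((x.2.2, x.2.1), (x.1.2, x.1.1)).
Lemma swap_funM : {morph swap_fun : x y / (x * y)%g}. Proof. by []. Qed.
Definition swap_hom : hom ((G * H) * (H * K))%type ((K * H) * (H * G))%type :=
  @Morphism _ _ setT _ (in2W swap_funM).

Lemma Ind_tau_contract :
  biso (bcomp (Ind (tau_hom K G)) (contract K H G))
       (bcomp (contract G H K) (Res swap_hom)).
Proof.
pose Z := bcomp (contract G H K) (Res swap_hom).
pose c (p : Ind (tau_hom K G)) (t : contract K H G) : contract G H K :=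
  ((p.1 * t.2, t.1.2^-1), p.2 * t.1.1)%g.
pose f p t : Z := bpair (c p t) (1%g : Res swap_hom).
pose s (r : (K * H) * (H * G)) : (G * H) * (H * K) :=
  ((r.2.2, r.2.1), (r.1.2, r.1.1)).
have sK r : swap_hom (s r) = r by case: r => [[? ?] [? ?]].
have bs (x : contract G H K) (r : Res swap_hom) :
    bpair x r = bpair (x >* s r) (1%g : Res swap_hom).
  rewrite bpairMl; congr bpair.
  by rewrite -[RHS]/(swap_hom (s r) * 1)%g mulg1 sK.
apply: (@bcomp_biso _ _ _ _ _ Z f); rewrite /f.
- by move=> [p q] [a b] [[x y] z]; rewrite /c /lact /ract /= !mulgA.
- move=> [p q] [[x y] z] [p' q'] [[x' y'] z'] /bpairP[r].
  rewrite /c /lact /ract /= mulg1 => + er.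
  have -> : r = 1%g.
    by case: r er => [[? ?] [? ?]] [-> -> -> ->].
  rewrite /contract_ract /= !mulg1 invg1 mul1g => -[e1 /invg_inj e2 e3].
  apply/bpairP; exists (q'^-1 * q, p'^-1 * p)%g.
    by rewrite /ract /=; congr (_, _); rewrite /= mulgA mulgV mul1g.
  by rewrite /lact /= /contract_lact /= e2 -!mulgA e1 e3 !mulgA !mulVg !mul1g.
- elim/bcomp_ind=> x r; rewrite bs; case: (x >* s r) => [[a b] d].
  exists (a, d), ((1, b^-1), 1)%g.
  by rewrite /c /= !mulg1 invgK.
- move=> [a b] [p q] [[x y] z]; rewrite [RHS]bcomp_lactE; congr bpair.
  by rewrite /c /lact /= /contract_lact /= !mulgA.
- move=> [p q] [[x y] z] [[a b] [d e]]; rewrite [RHS]bcomp_ractE.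
  rewrite [RHS]bs; congr bpair.
  by rewrite /c /ract /= /contract_ract /= !mul1g !invMg invgK !mulgA.
Qed.

End BisetIsos.

Section IsoT.
Variables (k : comPzRingType) (D : group_class) (A : green_functor k D).

Lemma fRes_comp (G H K : obj D) (phi : hom G H) (psi : hom H K) (chi : hom G K)
    (a : A K) :
  (forall g, chi g = psi (phi g)) ->
  fRes A phi (fRes A psi a) = fRes A chi a.
Proof.
move=> e; rewrite /fRes -fmap_comp burnk_comp_cls.
by rewrite (bclsk_iso k (Res_comp e)).
Qed.

Lemma fRes_sq (G H H' K : obj D) (phi : hom G H) (psi : hom H K)
    (phi' : hom G H') (psi' : hom H' K) (a : A K) :
  (forall g, psi (phi g) = psi' (phi' g)) ->
  fRes A phi (fRes A psi a) = fRes A phi' (fRes A psi' a).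
Proof.
move=> e; have chiM : {morph (fun g => psi (phi g)) : x y / (x * y)%g}.
  by move=> x y; rewrite !homM.
by rewrite !(@fRes_comp _ _ _ _ _ (@Morphism _ _ setT _ (in2W chiM))).
Qed.

(* tau_hom is an isomorphism, hence Iso(tau) = Ind(tau) *)
Definition Tmap (G H : obj D) :
    {linear lhom (PA (gop A)) G H -> lhom (lopp (PA A)) G H} :=
  @fInd k D A (oprod H G) (oprod G H) (tau_hom H G).

Definition Tinv_map (G H : obj D) :
    {linear lhom (lopp (PA A)) G H -> lhom (PA (gop A)) G H} :=
  @fInd k D A (oprod G H) (oprod H G) (tau_hom G H).

Lemma tau_Res (G H : obj D) (a : A (oprod H G)) :
  @fInd k D A (oprod H G) (oprod G H) (tau_hom H G) a =
  @fRes k D A (oprod G H) (oprod H G) (tau_hom G H) a.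
Proof.
rewrite /fInd /fRes (bclsk_iso k (@Ind_Res _ _ _ (tau_hom G H) _ _)) //; by case.
Qed.

Lemma tauK (G H : obj D) (a : A (oprod H G)) :
  @fInd k D A (oprod G H) (oprod H G) (tau_hom G H)
    (@fInd k D A (oprod H G) (oprod G H) (tau_hom H G) a) = a.
Proof.
rewrite !tau_Res (@fRes_comp _ _ _ _ _ (id_hom _)); last by case.
by rewrite /fRes (bclsk_iso k (@Res_id _ _ _)) ?fmap_id.
Qed.

Lemma TmapK G H : cancel (Tmap G H) (Tinv_map G H).
Proof. by move=> a; apply: tauK. Qed.

Lemma Tinv_mapK G H : cancel (Tinv_map G H) (Tmap G H).
Proof. by move=> a; apply: tauK. Qed.

Lemma Tmap_comp G H K (u : lhom (PA (gop A)) H K) (v : lhom (PA (gop A)) G H) :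
  Tmap G K (lcomp u v) = lcomp (Tmap H K u) (Tmap G H v).
Proof.
rewrite /= /pa_comp /fInd -fmap_comp burnk_comp_cls.
pose X := oprod (oprod G H) (oprod H K).
pose Y := oprod (oprod K H) (oprod H G).
rewrite (bclsk_iso k (Ind_tau_contract K H G)) -burnk_comp_cls.
rewrite (@fmap_comp k D A Y X (oprod G K)); congr (fmap _ _ _).
rewrite -[LHS]/(@fRes k D A X Y (swap_hom K H G) _) [LHS](gresM (gaxioms A)).
rewrite -!/(fInd _ _) !tau_Res.
by congr (gmul _ _); apply: fRes_sq.
Qed.

Lemma Tmap_id G : Tmap G G (lid (PA (gop A)) G) = lid (lopp (PA A)) G.
Proof.
rewrite /= /pa_id /fInd -fmap_comp burnk_comp_cls.
by rewrite (bclsk_iso k (Ind_tau_diag G)).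
Qed.

Definition T_iso : linfunctor (PA (gop A)) (lopp (PA A)) :=
  LinFunctor Tmap_comp Tmap_id.

Lemma Tinv_map_comp G H K
    (u : lhom (lopp (PA A)) H K) (v : lhom (lopp (PA A)) G H) :
  Tinv_map G K (lcomp u v) = lcomp (Tinv_map H K u) (Tinv_map G H v).
Proof.
rewrite -{1}[u](Tinv_mapK u) -{1}[v](Tinv_mapK v) -Tmap_comp.
exact: TmapK.
Qed.

Lemma Tinv_map_id G : Tinv_map G G (lid (lopp (PA A)) G) = lid (PA (gop A)) G.
Proof. exact: etrans (congr1 _ (esym (Tmap_id G))) (TmapK _). Qed.

Definition T_inv : linfunctor (lopp (PA A)) (PA (gop A)) :=
  LinFunctor Tinv_map_comp Tinv_map_id.

Lemma T_isoK : lf_eq (lf_compose T_inv T_iso) (lf_idfun _).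
Proof. by move=> G H a; apply: tauK. Qed.

Lemma T_invK : lf_eq (lf_compose T_iso T_inv) (lf_idfun _).
Proof. by move=> G H a; apply: tauK. Qed.

End IsoT.

(* Main.v *)
From mathcomp Require Import all_boot all_order all_algebra all_fingroup.
Require Import Defs.

Set Implicit Arguments.
Unset Strict Implicit.

Import GRing.Theory.
Local Open Scope ring_scope.

(** A multiplicative natural transformation [A -> A^op] induces a functor
    [P_A -> P_{A^op}], and composing with [T] gives the required contravariant
    functor.  Conversely, [T^-1 o bullet] is only defined on the groups [H x G],
    but [G] is isomorphic to [G x 1], and compatibility with all bisets makes
    the transported map natural.  The product is recovered from the composition
    through the object [1]: viewing [a] in [P_A(1, G)] and [b] in [P_A(G, 1)],
    the composite [a o b] in [A(G x G)] is [a x b], and its restriction along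
    the diagonal is [a b]. *)

Section ProductFromComposition.
Variables K G : finGroupType.

Definition unit_pad_fun (x : K * G) : (K * unit) * (unit * G) :=
  ((x.1, tt), (tt, x.2)).
Lemma unit_pad_funM : {morph unit_pad_fun : x y / (x * y)%g}.
Proof. by []. Qed.
Definition unit_pad_hom : hom (K * G)%type ((K * unit) * (unit * G))%type :=
  @Morphism _ _ setT _ (in2W unit_pad_funM).

(** Contraction over the trivial group merely drops its coordinates, so composition through the
    object 1 is a restriction, hence multiplicative. *)
Lemma contract_unit : biso (contract K unit G) (Res unit_pad_hom).
Proof.
exists (fun t => ((t.1.1, tt), (tt, t.2))); split.
- exists (fun r => ((r.1.1, tt), r.2.2)); first by case=> [[? []] ?].
  by case=> [[? []] [[] ?]].
- by move=> [a b] [[x []] y].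
- by move=> [[x []] y] [[a []] [[] b]].
Qed.

Definition dup_fun (x : G) := (x, x).
Lemma dup_funM : {morph dup_fun : x y / (x * y)%g}. Proof. by []. Qed.
Definition dup_hom : hom G (G * G)%type := @Morphism _ _ setT _ (in2W dup_funM).

Definition pad1_fun (x : G) := (x, tt).
Lemma pad1_funM : {morph pad1_fun : x y / (x * y)%g}. Proof. by []. Qed.
Definition pad1_hom : hom G (G * unit)%type :=
  @Morphism _ _ setT _ (in2W pad1_funM).

End ProductFromComposition.

Section Green.
Variables (k : comPzRingType) (D : group_class).

Lemma fRes_id (A : green_functor k D) (G : obj D) (phi : hom G G) (a : A G) :
  phi =1 id -> fRes A phi a = a.
Proof. by move=> e; rewrite /fRes (bclsk_iso k (Res_id e)) fmap_id. Qed.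

Lemma gmul_pa_comp (A : green_functor k D) (G : obj D) (a b : A G) :
  gmul a b =
  @fRes k D A G (oprod G G) (dup_hom G)
    (@pa_comp k D A G (ounit D) G
       (@fRes k D A (oprod G (ounit D)) G (fst_hom G unit) a)
       (@fRes k D A (oprod (ounit D) G) G (snd_hom unit G) b)).
Proof.
pose U := ounit D; pose X := oprod (oprod G U) (oprod U G).
rewrite /pa_comp (bclsk_iso k (contract_unit G G)).
rewrite -[fmap _ _ _]/(@fRes k D A (oprod G G) X (unit_pad_hom G G) _).
rewrite /gcross !(gresM (gaxioms A)).
(* Both factors are restricted along the outer projections [f1] and [f2]; pulled back along the
   padding and the diagonal, each becomes the identity of [G]. *)
pose f1 : hom X G := @Morphism _ _ setT (fun x : X => x.1.1)
  (in2W (fun x y : X => erefl (x.1.1 * y.1.1)%g)).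
pose f2 : hom X G := @Morphism _ _ setT (fun x : X => x.2.2)
  (in2W (fun x y : X => erefl (x.2.2 * y.2.2)%g)).
rewrite (@fRes_comp k D A X (oprod G U) G _ _ f1) //.
rewrite (@fRes_comp k D A X (oprod U G) G _ _ f2) //.
rewrite (@fRes_comp k D A (oprod G G) X G _ _ (fst_hom G G)) //.
rewrite (@fRes_comp k D A (oprod G G) X G _ _ (snd_hom G G)) //.
rewrite (@fRes_comp k D A G (oprod G G) G _ _ (id_hom G)) //.
rewrite (@fRes_comp k D A G (oprod G G) G _ _ (id_hom G)) //.
by rewrite !fRes_id.
Qed.

(** Evaluate [s] on 1 s(1): as s(s(1)) it is 1, as s(s(1)) s(1) it is s(1). *)
Lemma anti_involution1 (A : green_functor k D) (s : nat_trans A A) :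
  anti_involution s -> forall G : obj D, s G (gone A G) = gone A G.
Proof.
case=> sK sM G; have := sM G (gone A G) (s G (gone A G)).
by rewrite sK !(gmul1l (gaxioms A)) sK => <-.
Qed.

Section InducedFunctor.
Variables (A C : green_functor k D) (f : green_mor A C).

Lemma green_mor_comp (G H K : obj D) (u : lhom (PA A) H K) (v : lhom (PA A) G H) :
  f (oprod K G) (lcomp u v) = lcomp (f (oprod K H) u : lhom (PA C) H K) (f (oprod H G) v).
Proof.
rewrite /= /pa_comp nt_nat gm_mul.
by congr (fmap _ _ (gmul _ _)); apply: nt_nat.
Qed.

Lemma green_mor_id (G : obj D) : f (oprod G G) (lid (PA A) G) = lid (PA C) G.
Proof. by rewrite /= /pa_id nt_nat gm_one. Qed.

Definition PA_map : linfunctor (PA A) (PA C) :=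
  @LinFunctor k _ (PA A) (PA C) (fun G H => f (oprod H G))
    green_mor_comp green_mor_id.
End InducedFunctor.

Section AntiInvolutionFromFunctor.
Variables (A : green_functor k D) (bullet : linfunctor (PA A) (lopp (PA A))).
Hypothesis bulletK :
  lf_eq (lf_compose (lf_op bullet) bullet) (lf_idfun (PA A)).

(** This is [T^-1 o bullet], read as an endomorphism because [P_A(G, H)] and [P_{A^op}(G, H)] are
    the same module. *)
Let theta (H G : obj D) : {linear A (oprod H G) -> A (oprod H G)} :=
  lf_compose (T_inv A) bullet G H.

Hypothesis theta_nat : forall (G H K L : obj D)
  (x : burnk k (oprod L K) (oprod H G)) (a : A (oprod H G)),
  theta L K (fmap A x a) = fmap A x (theta H G a).

(** Naturality for the flip biset moves the inner flip outside, where the two flips cancel and leave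
    [bullet] applied twice. *)
Lemma theta_invol H G (a : A (oprod H G)) : theta H G (theta H G a) = a.
Proof.
transitivity (fmap A (bclsk k (Ind (tau_hom G H)) : burnk k (oprod H G) (oprod G H))
  (theta G H (bullet G H a))).
  exact: (@theta_nat H G G H (bclsk k (Ind (tau_hom G H))) (bullet G H a)).
transitivity (bullet H G (bullet G H a)); first exact: (@tauK k D A G H).
exact: (bulletK a).
Qed.

Lemma theta_comp (G H K : obj D) (u : A (oprod K H)) (v : A (oprod H G)) :
  theta K G (pa_comp u v) =
  @pa_comp k D (gop A) G H K (theta K H u) (theta H G v).
Proof. exact: (lf_comp (lf_compose (T_inv A) bullet) u v). Qed.

Let proj (G : obj D) : {linear A (oprod G (ounit D)) -> A G} :=
  @fRes k D A G (oprod G (ounit D)) (pad1_hom G).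
Let pad (G : obj D) : {linear A G -> A (oprod G (ounit D))} :=
  @fRes k D A (oprod G (ounit D)) G (fst_hom G unit).

Lemma padK G a : proj G (pad G a) = a.
Proof.
rewrite /proj /pad (@fRes_comp k D A G (oprod G (ounit D)) G _ _ (id_hom G)) //.
exact: fRes_id.
Qed.

Lemma projK G a : pad G (proj G a) = a.
Proof.
pose P := oprod G (ounit D).
rewrite /proj /pad (@fRes_comp k D A P G P _ _ (id_hom P)); last by case=> x [].
exact: fRes_id.
Qed.

Definition star_app (G : obj D) : {linear A G -> A G} :=
  proj G \o (theta G (ounit D) \o pad G).

Lemma star_nat (G H : obj D) (x : burnk k H G) (a : A G) :
  star_app H (fmap A x a) = fmap A x (star_app G a).
Proof.
pose U := ounit D.
(* Conjugating [x] by the padding isomorphisms gives an element between products, to which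
   [theta_nat] applies. *)
pose y : burnk k (oprod H U) (oprod G U) := burnk_comp (burnk_comp
  (bclsk k (Res (fst_hom H unit))) x) (bclsk k (Res (pad1_hom G))).
have yE b : fmap A y b = pad H (fmap A x (proj G b)).
  by rewrite /y (@fmap_comp k D A (oprod G U) G) (@fmap_comp k D A G H).
transitivity (proj H (fmap A y (theta G U (pad G a)))); last by rewrite yE padK.
have e : pad H (fmap A x a) = fmap A y (pad G a) by rewrite yE padK.
apply: (congr1 (proj H)); rewrite -(@theta_nat U G U H y (pad G a)).
exact: (congr1 (theta H U) e).
Qed.

(** Inflation from [H x G] to [(H x G) x 1] relates two different splittings into factors, and
    [theta_nat] allows this. *)
Lemma star_theta (H G : obj D) (a : A (oprod H G)) :
  star_app (oprod H G) a = theta H G a.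
Proof.
pose P := oprod H G; pose U := ounit D.
transitivity (proj P (pad P (theta H G a))); last exact: padK.
apply: (congr1 (proj P)).
exact: (@theta_nat G H U P (bclsk k (Res (fst_hom P unit)))).
Qed.

Definition star : nat_trans A A := NatTrans star_nat.

Lemma star_anti_involution : anti_involution star.
Proof.
pose U := ounit D; split=> G a.
  transitivity (proj G (theta G U (theta G U (pad G a)))).
    exact: (congr1 (fun z => proj G (theta G U z)) (projK _)).
  by rewrite theta_invol padK.
move=> b.
(* On [G x G] the map [star] is [theta], a functor into [P_{A^op}], so the composite becomes one
   whose product is reversed. *)
rewrite [in LHS]gmul_pa_comp nt_nat.
rewrite [star _ _]star_theta theta_comp -!star_theta.
rewrite -[star_app]/(nt_app star) !nt_nat.
exact/esym/(@gmul_pa_comp (gop A)).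
Qed.

End AntiInvolutionFromFunctor.

End Green.

Theorem theorem4p6 (k : comPzRingType) (D : group_class)
    (A : green_functor k D) :
  [<-> exists s : nat_trans A A, anti_involution s;

       exists (delta : green_mor A (gop A)) (delta_inv : green_mor (gop A) A),
         gmor_inverse delta delta_inv /\ gmor_eq (gmor_op delta) delta_inv;

       exists bullet : linfunctor (PA A) (lopp (PA A)),
         lf_eq (lf_compose (lf_op bullet) bullet) (lf_idfun (PA A)) /\
         (forall (G H K L : obj D) (x : burnk k (oprod L K) (oprod H G))
                 (alpha : lhom (PA A) G H),
            lf_compose (T_inv A) bullet K L
              (@fmap k D A (oprod H G) (oprod L K) x alpha) =
            @fmap k D (gop A) (oprod H G) (oprod L K) x
              (lf_compose (T_inv A) bullet G H alpha))].
Proof.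
tfae.
- case=> s sA; have s1 := anti_involution1 sA; case: sA => sK sM.
  (* The same components [s] serve as [delta] and as its inverse. *)
  exists (@GreenMor k D A (gop A) s sM s1).
  exists (@GreenMor k D (gop A) A s (fun G a b => sM G b a) s1).
  by split=> G //; split; apply: sK.
- case=> delta [delta_inv [inv eqd]].
  have deltaK G (a : A G) : delta G (delta G a) = a.
    by rewrite [LHS](eqd G) (inv G).1.
  exists (lf_compose (T_iso A) (PA_map delta)); split=> [G H a | G H K L x a].
    (* Naturality of [delta] for the flip brings the two copies of [delta] together. *)
    have e : delta (oprod G H) (Tmap A G H (delta (oprod H G) a)) =
        Tmap A G H (delta (oprod H G) (delta (oprod H G) a)).
      exact: (nt_nat delta).
    rewrite deltaK in e.
    exact: etrans (congr1 (Tmap A H G) e) (@tauK k D A G H a).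
  (* Once [T^-1] cancels [T], condition (b) is the naturality of [delta]. *)
  have eT G' H' b : Tinv_map A G' H' (Tmap A G' H' b) = b by exact: tauK.
  exact: etrans (eT _ _ _)
    (etrans (nt_nat delta x a) (congr1 (fmap A x) (esym (eT _ _ _)))).
- case=> bullet [bulletK bullet_nat].
  exact: ex_intro (star_anti_involution bulletK bullet_nat).
Qed.
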